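(* Let $n\ge1$ and let $\langle A,\to,\neg,1\rangle$ be an $(n+1)$-valued Wajsberg algebra, and let $B(A)=\{x\in A: x\odot x=x\}$ be its Boolean subalgebra. For each $d\in Div(n)$ let $h_A(d)=P_d\cap B(A)$, where $P_d=\bigcap\{P\in\chi(A): A/P \text{ is isomorphic to a subalgebra of } L_{d+1}\}$. Then the map $\varphi:A\to M(B(A),h_A)$ given by $\varphi(x)(i)=\sigma_i(x)$ for $x\in A$ and $1\le i\le n$ is a well-defined isomorphism of Wajsberg algebras.
   Context: A Wajsberg algebra is an algebra $\langle A,\to,\neg,1\rangle$ of type $(2,1,0)$ satisfying $1\to x=x$, $(x\to y)\to((y\to z)\to(x\to z))=1$, $(x\to y)\to y=(y\to x)\to x$, $(\neg y\to\neg x)\to(x\to y)=1$. Derived operations: $0=\neg1$, $x\vee y=(x\to y)\to y$, $x\wedge y=\neg(\neg x\vee\neg y)$, $x\odot y=\neg(x\to\neg y)$; $x\le y$ iff $x\to y=1$. $L_{n+1}$ is the Wajsberg algebra $\{0,\frac1n,\ldots,\frac{n-1}n,1\}$ with $x\to y=\min\{1,1-x+y\}$, $\neg x=1-x$; $L_{d+1}$ is a subalgebra of $L_{n+1}$ when $d\mid n$. An $(n+1)$-valued Wajsberg algebra is one in the variety generated by $L_{n+1}$. An implicative filter of $A$ is a set $F\ni 1$ such that $a, a\to b\in F$ imply $b\in F$; implicative filters correspond to congruences, and $A/F$ is the quotient. $\chi(A)$ is the set of prime implicative filters (implicative filters that are prime lattice filters), i.e. those $P$ with $A/P$ a chain;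 an empty intersection is taken to be $A$. The Moisil operators $\sigma_i$ ($1\le i\le n$) on $A$ are the unary operations (definable from the Wajsberg operations) such that for every homomorphism $g:A\to L_{n+1}$ and $x\in A$, $g(\sigma_i(x))=1$ if $g(x)\ge\frac{n-i+1}{n}$ and $g(\sigma_i(x))=0$ otherwise; each $\sigma_i(x)\in B(A)$. For a Boolean algebra $B$ and a function $h$ from $Div(n)$ (positive divisors of $n$) into the filters of $B$: $B^{[n]}$ is the set of increasing functions $\{1,\ldots,n\}\to B$; $\xi_{d,q}(f)=f(q\frac nd)\to f((q-1)\frac nd+1)$ (with $a\to b=\neg a\vee b$) for $d\in Div(n)$, $1\le q\le d$; $M(B,h)=\{f\in B^{[n]}:\xi_{d,q}(f)\in h(d)\ \forall d\in Div(n),\ 1\le q\le d\}$, a Wajsberg algebra with $\mathbb I$ the constant $1$, $(\neg f)(k)=\neg f(n+1-k)$, $(f\Rightarrow g)(k)=\bigwedge_{i=1}^{n-k+1}(f(i)\to g(i+k-1))$. *)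

(* Defs.v *)
From HB Require Import structures.
From mathcomp Require Import all_boot all_order.
From mathcomp Require Import generic_quotient boolp classical_sets.
From mathcomp Require Import zify.

Set Implicit Arguments.
Unset Strict Implicit.
Unset Printing Implicit Defensive.

Import Order.Theory.

Declare Scope wajsberg_scope.
Delimit Scope wajsberg_scope with W.
Local Open Scope quotient_scope.
Local Open Scope wajsberg_scope.

HB.mixin Record hasWajsbergOps T of Choice T := {
  wimp : T -> T -> T;
  wneg : T -> T;
  wone : T
}.

#[short(type="wopsType")]
HB.structure Definition WajsbergOps := {T of Choice T & hasWajsbergOps T}.

Arguments wone {_}.
Notation "x ~~> y" := (wimp x y)
  (at level 55, right associativity) : wajsberg_scope.
Notation "¬ x" := (wneg x)
  (at level 35, right associativity) : wajsberg_scope.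
Notation "1" := wone : wajsberg_scope.

HB.mixin Record isWajsberg T of WajsbergOps T := {
  wimp1x : forall x : T, 1 ~~> x = x;
  wimp_trans : forall x y z : T,
    (x ~~> y) ~~> ((y ~~> z) ~~> (x ~~> z)) = 1;
  wimp_join : forall x y : T, (x ~~> y) ~~> y = (y ~~> x) ~~> x;
  wimp_contra : forall x y : T, (¬ y ~~> ¬ x) ~~> (x ~~> y) = 1
}.

#[short(type="wajsbergType")]
HB.structure Definition Wajsberg := {T of WajsbergOps T & isWajsberg T}.

Section DerivedOperations.
Variable A : wopsType.
Implicit Types x y : A.

Definition wzero : A := ¬ 1.
Definition wjoin x y := (x ~~> y) ~~> y.
Definition wmeet x y := ¬ (wjoin (¬ x) (¬ y)).
Definition wodot x y := ¬ (x ~~> ¬ y).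
Definition wle x y := x ~~> y = 1.

End DerivedOperations.

Arguments wzero {A}.

Definition whom (A B : wopsType) (f : A -> B) : Prop :=
  [/\ f 1 = 1,
      forall x y, f (x ~~> y) = f x ~~> f y &
      forall x, f (¬ x) = ¬ (f x)].

Definition wsubalgebra (B : wopsType) (S : set B) : Prop :=
  [/\ S 1,
      forall x y, S x -> S y -> S (x ~~> y) &
      forall x, S x -> S (¬ x)].

(* [f] is an isomorphism from [A] onto the set [S], with the operations of [S]
   inherited from [B]. *)
Definition wiso_onto (A B : wopsType) (f : A -> B) (S : set B) : Prop :=
  [/\ forall x, S (f x),
      whom f,
      injective f &
      forall y, S y -> exists x, f x = y].

(* The element [k : luk n] stands for the rational number [k / n]. *)
Definition luk (n : nat) : Type := 'I_n.+1.
HB.instance Definition _ n := Choice.on (luk n).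

Section Lukasiewicz.
Variable n : nat.
Implicit Types x y z : luk n.

Definition luk_imp x y : luk n := inord (minn n (n - x + y)).
Definition luk_neg x : luk n := inord (n - x).
Definition luk_one : luk n := ord_max.

HB.instance Definition _ :=
  hasWajsbergOps.Build (luk n) luk_imp luk_neg luk_one.

Lemma val_luk_imp x y : (x ~~> y : luk n) = minn n (n - x + y) :> nat.
Proof. by rewrite inordK // ltnS geq_minl. Qed.

Lemma val_luk_neg x : (¬ x : luk n) = n - x :> nat.
Proof. by rewrite inordK // ltnS leq_subr. Qed.

Lemma val_luk_one : (1 : luk n) = n :> nat. Proof. by []. Qed.

Let le_n x : x <= n. Proof. by rewrite -ltnS ltn_ord. Qed.

Let vE := (val_luk_imp, val_luk_neg, val_luk_one).

Lemma luk_imp1x x : 1 ~~> x = x.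
Proof. by apply: ord_inj; have := le_n x; rewrite !vE; lia. Qed.

Lemma luk_imp_trans x y z : (x ~~> y) ~~> ((y ~~> z) ~~> (x ~~> z)) = 1.
Proof.
by apply: ord_inj; have := (le_n x, le_n y, le_n z); rewrite !vE => -[[]]; lia.
Qed.

Lemma luk_imp_join x y : (x ~~> y) ~~> y = (y ~~> x) ~~> x.
Proof.
by apply: ord_inj; have := (le_n x, le_n y); rewrite !vE => -[]; lia.
Qed.

Lemma luk_imp_contra x y : (¬ y ~~> ¬ x) ~~> (x ~~> y) = 1.
Proof.
by apply: ord_inj; have := (le_n x, le_n y); rewrite !vE => -[]; lia.
Qed.

HB.instance Definition _ := isWajsberg.Build (luk n)
  luk_imp1x luk_imp_trans luk_imp_join luk_imp_contra.

End Lukasiewicz.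

Inductive wterm : Type :=
  | TVar of nat
  | TImp of wterm & wterm
  | TNeg of wterm
  | TOne.

Fixpoint weval (A : wopsType) (e : nat -> A) (t : wterm) : A :=
  match t with
  | TVar k => e k
  | TImp t1 t2 => weval e t1 ~~> weval e t2
  | TNeg t1 => ¬ (weval e t1)
  | TOne => 1
  end.

Definition wsatisfies (A : wopsType) (eqn : wterm * wterm) : Prop :=
  forall e : nat -> A, weval e eqn.1 = weval e eqn.2.

(* Varieties are taken as equational classes. *)
Definition wvariety (V : wopsType -> Prop) : Prop :=
  exists E : set (wterm * wterm),
    forall A : wopsType, V A <-> forall eqn, E eqn -> wsatisfies A eqn.

Definition in_variety_generated_by (K A : wopsType) : Prop :=
  forall V : wopsType -> Prop, wvariety V -> V K -> V A.

(* [valued n A]: the Wajsberg algebra [A] is (n+1)-valued. *)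
Definition valued (n : nat) (A : wajsbergType) : Prop :=
  in_variety_generated_by (luk n) A.

Section WajsbergTheory.
Variable A : wajsbergType.
Implicit Types x y z : A.

Lemma wimpxx x : x ~~> x = 1.
Proof. by have := wimp_trans 1 1 x; rewrite !wimp1x. Qed.

Lemma wle_refl x : wle x x. Proof. exact: wimpxx. Qed.

Lemma wle_anti x y : wle x y -> wle y x -> x = y.
Proof.
by rewrite /wle => xy yx; have := wimp_join x y; rewrite xy yx !wimp1x.
Qed.

Lemma wle1 x : wle x 1.
Proof.
have E : (x ~~> 1) ~~> 1 = 1 by rewrite wimp_join wimp1x wimpxx.
by have := wimp_trans 1 x 1; rewrite wimp1x wimpxx E.
Qed.

Lemma wle1x x : wle 1 x -> x = 1.
Proof. by rewrite /wle wimp1x. Qed.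

Lemma wle_trans y x z : wle x y -> wle y z -> wle x z.
Proof.
by rewrite /wle => xy yz; have := wimp_trans x y z; rewrite xy yz !wimp1x.
Qed.

Lemma wle_imptr x y z : wle (x ~~> y) ((y ~~> z) ~~> (x ~~> z)).
Proof. exact: wimp_trans. Qed.

Lemma wle_contra x y : wle (¬ y ~~> ¬ x) (x ~~> y).
Proof. exact: wimp_contra. Qed.

Lemma wle_imp2r z x y : wle x y -> wle (y ~~> z) (x ~~> z).
Proof. by rewrite /wle => xy; have := wimp_trans x y z; rewrite xy wimp1x. Qed.

Lemma wle_impK x y : wle x (y ~~> x).
Proof. by have := wimp_trans y 1 x; rewrite wle1 !wimp1x. Qed.

Lemma wle_joinl x y : wle x (wjoin x y).
Proof. by rewrite /wjoin wimp_join; apply: wle_impK. Qed.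

Lemma wle_joinr x y : wle y (wjoin x y).
Proof. exact: wle_impK. Qed.

Lemma wimpCA x y z : x ~~> (y ~~> z) = y ~~> (x ~~> z).
Proof.
have H (a b c : A) : wle (a ~~> (b ~~> c)) (b ~~> (a ~~> c)).
  apply: wle_trans (wle_imptr a (b ~~> c) c) _.
  exact/wle_imp2r/wle_joinl.
by apply: wle_anti.
Qed.

Lemma wle_imp2l z x y : wle x y -> wle (z ~~> x) (z ~~> y).
Proof.
rewrite /wle => xy; have := wimp_trans z x y.
by rewrite (wimpCA (z ~~> x) (x ~~> y)) xy wimp1x.
Qed.

Lemma wneg_wzero_le x : wle (¬ x ~~> wzero) x.
Proof. by have := wimp_contra 1 x; rewrite wimp1x. Qed.

Lemma wle0 x : wle wzero x.
Proof. exact: wle_trans (wle_impK _ (¬ x)) (wneg_wzero_le x). Qed.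

Lemma wnegE x : ¬ x = x ~~> wzero.
Proof.
have H (y : A) : wle (¬ y) (y ~~> wzero).
  exact: wle_trans (wle_impK _ (¬ wzero)) (wle_contra y wzero).
apply: wle_anti (H x) _.
apply: wle_trans (wneg_wzero_le (¬ x)).
apply: wle_imp2r; exact: wle_trans (H _) (wneg_wzero_le x).
Qed.

Lemma wnegK x : ¬ (¬ x) = x.
Proof. by rewrite !wnegE wimp_join wle0 wimp1x. Qed.

Lemma wneg_inj : injective (@wneg A). Proof. exact: (can_inj wnegK). Qed.

Lemma wimpNN x y : ¬ y ~~> ¬ x = x ~~> y.
Proof.
by apply: wle_anti (wle_contra x y) _; rewrite !wnegE; apply: wimp_trans.
Qed.

Lemma wimpxN x y : x ~~> ¬ y = y ~~> ¬ x.
Proof. by rewrite -wimpNN wnegK. Qed.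

Lemma wjoinC x y : wjoin x y = wjoin y x. Proof. exact: wimp_join. Qed.

Lemma wjoin_lub x y z : wle x z -> wle y z -> wle (wjoin x y) z.
Proof.
move=> xz yz; have -> : z = wjoin z y by rewrite wjoinC /wjoin yz wimp1x.
by apply/wle_imp2r/wle_imp2r.
Qed.

Lemma wleNN x y : wle x y -> wle (¬ y) (¬ x).
Proof. by rewrite /wle wimpNN. Qed.

Lemma wle_meetl x y : wle (wmeet x y) x.
Proof. by rewrite -{2}(wnegK x); apply/wleNN/wle_joinl. Qed.

Lemma wle_meetr x y : wle (wmeet x y) y.
Proof. by rewrite -{2}(wnegK y); apply/wleNN/wle_joinr. Qed.

Lemma wmeet_glb x y z : wle z x -> wle z y -> wle z (wmeet x y).
Proof.
by move=> zx zy; rewrite -(wnegK z); apply/wleNN/wjoin_lub; apply: wleNN.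
Qed.

Lemma wodotC x y : wodot x y = wodot y x.
Proof. by rewrite /wodot wimpxN. Qed.

Lemma wodotA x y z : wodot x (wodot y z) = wodot (wodot x y) z.
Proof.
rewrite [RHS]wodotC /wodot !wnegK; congr wneg.
by rewrite (wimpCA z x) (wimpxN z y).
Qed.

Lemma wodot_adj x y z : wle (wodot x y) z <-> wle x (y ~~> z).
Proof.
by rewrite /wle /wodot -{1}(wnegK z) wimpNN wimpCA wimpNN.
Qed.

Lemma wle_odot2l z x y : wle x y -> wle (wodot z x) (wodot z y).
Proof.
move=> xy; rewrite wodotC; apply/wodot_adj; apply: wle_trans xy _.
by apply/wodot_adj; rewrite wodotC; apply: wle_refl.
Qed.

Lemma wodot_lel x y : wle (wodot x y) x.
Proof. exact/wodot_adj/wle_impK. Qed.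

Lemma wodot_ler x y : wle (wodot x y) y.
Proof. by rewrite wodotC; apply: wodot_lel. Qed.

Lemma wodot_div x y : wodot x (x ~~> y) = wmeet x y.
Proof.
by rewrite wodotC /wmeet wjoinC /wjoin wimpNN.
Qed.

Lemma wodot_meet x y : wodot x x = x -> wodot x y = wmeet x y.
Proof.
move=> xx; apply: wle_anti.
  by apply: wmeet_glb; [apply: wodot_lel | apply: wodot_ler].
have {1}-> : wmeet x y = wodot x (wmeet x y).
  by rewrite -wodot_div wodotA xx.
exact/wle_odot2l/wle_meetr.
Qed.

Lemma wodot_neg x : wodot x x = x -> wodot (¬ x) (¬ x) = ¬ x.
Proof.
move=> /(congr1 (@wneg A)); rewrite /wodot !wnegK => xN; congr wneg.
apply: wle_anti (wle_impK _ _).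
by rewrite /wle -wimp_join xN wimpxx.
Qed.

Lemma wodot_meet_idem x y :
  wodot x x = x -> wodot y y = y ->
  wodot (wmeet x y) (wmeet x y) = wmeet x y.
Proof.
move=> xx yy; rewrite -!(wodot_meet _ xx).
by rewrite -wodotA [wodot y _]wodotC -wodotA yy wodotA xx.
Qed.

Lemma wmeetNN x y : wjoin x y = ¬ (wmeet (¬ x) (¬ y)).
Proof. by rewrite /wmeet !wnegK. Qed.

Lemma wodot_join_idem x y :
  wodot x x = x -> wodot y y = y ->
  wodot (wjoin x y) (wjoin x y) = wjoin x y.
Proof.
by move=> xx yy; rewrite wmeetNN; apply: wodot_neg;
   apply: wodot_meet_idem; apply: wodot_neg.
Qed.

Lemma wodot_joinr x y z :
  wodot x (wjoin y z) = wjoin (wodot x y) (wodot x z).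
Proof.
apply: wle_anti.
  rewrite wodotC; apply/wodot_adj/wjoin_lub; apply/wodot_adj; rewrite wodotC.
    exact: wle_joinl.
  exact: wle_joinr.
apply: wjoin_lub; apply: wle_odot2l; [exact: wle_joinl | exact: wle_joinr].
Qed.

Lemma wodot11 : wodot 1 1 = 1 :> A.
Proof. by rewrite /wodot wimp1x wnegK. Qed.

End WajsbergTheory.

Fact boolean_display : Order.disp_t. Proof. exact: (Order.Disp tt tt). Qed.

Record boolean_of (A : wajsbergType) := Boolean {
  bval :> A;
  bvalP : wodot bval bval == bval
}.
HB.instance Definition _ A := [isSub for @bval A].
HB.instance Definition _ A := [Choice of boolean_of A by <:].

Section BooleanElements.
Variable A : wajsbergType.
Local Notation B := (boolean_of A).
Implicit Types a b c : B.

Let idem a : wodot (val a) (val a) = val a.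
Proof. exact: (eqP (valP a)). Qed.

Definition bool_meet a b : B :=
  @Boolean A (wmeet (val a) (val b))
    (introT eqP (wodot_meet_idem (idem a) (idem b))).
Definition bool_join a b : B :=
  @Boolean A (wjoin (val a) (val b))
    (introT eqP (wodot_join_idem (idem a) (idem b))).
Definition bool_compl a : B :=
  @Boolean A (¬ (val a)) (introT eqP (wodot_neg (idem a))).
Definition bool_one : B := @Boolean A 1 (introT eqP (@wodot11 A)).
Definition bool_zero : B := bool_compl bool_one.
Definition bool_le a b := val a ~~> val b == 1.
Definition bool_lt a b := (b != a) && bool_le a b.

Let leP a b : reflect (wle (val a) (val b)) (bool_le a b).
Proof. exact: eqP. Qed.

Let bool_anti a b : wle (val a) (val b) -> wle (val b) (val a) -> a = b.
Proof. by move=> ab ba; apply/val_inj/wle_anti. Qed.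

Fact bool_le_def a b : bool_le a b = (bool_meet a b == a).
Proof.
apply/leP/eqP => [ab | <-]; last exact: wle_meetr.
apply: bool_anti; first exact: wle_meetl.
by apply: wmeet_glb => //; apply: wle_refl.
Qed.

Fact bool_lt_def a b : bool_lt a b = (b != a) && bool_le a b.
Proof. by []. Qed.

Let odotE a b : val (bool_meet a b) = wodot (val a) (val b).
Proof. by rewrite wodot_meet. Qed.

Fact bool_meetC : commutative bool_meet.
Proof. by move=> a b; apply: val_inj; rewrite !odotE wodotC. Qed.

Fact bool_joinC : commutative bool_join.
Proof. by move=> a b; apply: val_inj; apply: wjoinC. Qed.

Fact bool_meetA : associative bool_meet.
Proof. by move=> a b c; apply: val_inj; rewrite !odotE wodotA. Qed.

Let joinNN a b :
  bool_join a b = bool_compl (bool_meet (bool_compl a) (bool_compl b)).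
Proof. by apply: val_inj; apply: wmeetNN. Qed.

Let complK a : bool_compl (bool_compl a) = a.
Proof. by apply: val_inj; apply: wnegK. Qed.

Fact bool_joinA : associative bool_join.
Proof. by move=> a b c; rewrite !joinNN !complK bool_meetA. Qed.

Fact bool_joinKI b a : bool_meet a (bool_join a b) = a.
Proof. by apply/eqP; rewrite -bool_le_def; apply/leP/wle_joinl. Qed.

Fact bool_meetKU b a : bool_join a (bool_meet a b) = a.
Proof.
apply: bool_anti; last exact: wle_joinl.
by apply: wjoin_lub (wle_refl _) (wle_meetl _ _).
Qed.

Fact bool_meetUl : left_distributive bool_meet bool_join.
Proof.
move=> a b c; rewrite !(bool_meetC _ c); apply: val_inj.
by rewrite odotE /= wodot_joinr -!odotE.
Qed.

Fact bool_meetxx : idempotent_op bool_meet.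
Proof. by move=> a; apply: val_inj; rewrite odotE. Qed.

HB.instance Definition _ := Order.isMeetJoinDistrLattice.Build boolean_display B
  bool_le_def bool_lt_def bool_meetC bool_joinC bool_meetA bool_joinA
  bool_joinKI bool_meetKU bool_meetUl bool_meetxx.

Fact bool_le0 a : (bool_zero <= a)%O. Proof. exact/leP/wle0. Qed.
Fact bool_le1 a : (a <= bool_one)%O. Proof. exact/leP/wle1. Qed.

HB.instance Definition _ := Order.hasBottom.Build boolean_display B bool_le0.
HB.instance Definition _ := Order.hasTop.Build boolean_display B bool_le1.

Fact bool_joinxC a : (a `|` bool_compl a)%O = \top%O.
Proof.
apply/val_inj; rewrite /= /wjoin.
have -> : val a ~~> ¬ (val a) = ¬ (val a) by rewrite -{3}(idem a) wnegK.
exact: wimpxx.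
Qed.

Fact bool_meetxC a : (a `&` bool_compl a)%O = \bot%O.
Proof. by apply/val_inj => /=; rewrite /wmeet wjoinC; congr wneg;
  have /(congr1 val) := bool_joinxC (bool_compl a); rewrite /= wjoinC. Qed.

HB.instance Definition _ :=
  Order.TBDistrLattice_hasComplement.Build boolean_display B
    bool_joinxC bool_meetxC.

End BooleanElements.

Record ifilter (A : wajsbergType) := IFilter {
  ifilter_set :> A -> Prop;
  ifilter1 : ifilter_set 1;
  ifilterMP : forall a b, ifilter_set a -> ifilter_set (a ~~> b) ->
                ifilter_set b
}.

(* Implicative filters are lattice filters, so only properness and primeness
   have to be required. *)
Definition iprime (A : wajsbergType) (P : ifilter A) : Prop :=
  ~ P wzero /\ (forall x y : A, P (wjoin x y) -> P x \/ P y).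

Section Quotient.
Variables (A : wajsbergType) (F : ifilter A).
Implicit Types x y z : A.

Definition fcong : rel A := fun x y => `[< F (x ~~> y) /\ F (y ~~> x) >].

Lemma ifilter_le x y : wle x y -> F x -> F y.
Proof. by move=> xy Fx; apply: (ifilterMP Fx); rewrite xy; apply: ifilter1. Qed.

Let fcong_refl : reflexive fcong.
Proof. by move=> x; apply/asboolP; rewrite wimpxx; split; apply: ifilter1. Qed.

Let fcong_sym : symmetric fcong.
Proof. by move=> x y; apply/asboolP/asboolP => -[]. Qed.

Let Ftrans x y z : F (x ~~> y) -> F (y ~~> z) -> F (x ~~> z).
Proof.
by move=> Fxy Fyz; apply: (ifilterMP Fyz); apply: ifilter_le Fxy;
   apply: wimp_trans.
Qed.

Let fcong_trans : transitive fcong.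
Proof.
move=> y x z /asboolP[xy yx] /asboolP[yz zy].
by apply/asboolP; split; apply: (@Ftrans _ y).
Qed.

Canonical fcong_equiv := EquivRel fcong fcong_refl fcong_sym fcong_trans.

Definition wquot : Type := {eq_quot fcong_equiv}.
HB.instance Definition _ := Choice.on wquot.
HB.instance Definition _ := EqQuotient.on wquot.

(* The operations do not depend on the representatives: see [wpi_hom]. *)
HB.instance Definition _ := hasWajsbergOps.Build wquot
  (fun a b => \pi_wquot (repr a ~~> repr b))
  (fun a => \pi_wquot (¬ (repr a)))
  (\pi_wquot 1).

Lemma fcong_imp x x' y y' :
  fcong x x' -> fcong y y' -> fcong (x ~~> y) (x' ~~> y').
Proof.
move=> /asboolP[xx' x'x] /asboolP[yy' y'y]; apply/asboolP; split.
  apply: (@Ftrans _ (x' ~~> y)).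
    by apply: ifilter_le x'x; apply: wimp_trans.
  by apply: ifilter_le yy'; rewrite /wle wimpCA; apply: wimp_trans.
apply: (@Ftrans _ (x ~~> y')).
  by apply: ifilter_le xx'; apply: wimp_trans.
by apply: ifilter_le y'y; rewrite /wle wimpCA; apply: wimp_trans.
Qed.

Lemma fcong_neg x x' : fcong x x' -> fcong (¬ x) (¬ x').
Proof. by move=> /asboolP[? ?]; apply/asboolP; rewrite !wimpNN. Qed.

Lemma fcong_repr x : fcong (repr (\pi_wquot x)) x.
Proof. by apply/eqmodP; rewrite reprK. Qed.

Lemma wpi_hom : whom (\pi_wquot : A -> wquot).
Proof.
split=> // [x y | x]; apply/eqmodP; rewrite /= fcong_sym.
  by apply: fcong_imp; apply: fcong_repr.
exact/fcong_neg/fcong_repr.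
Qed.

End Quotient.

Definition iso_to_subalgebra (A L : wopsType) : Prop :=
  exists S : set L, wsubalgebra S /\ exists f : A -> L, wiso_onto f S.

Definition divisor_filter (A : wajsbergType) (d : nat) : set A :=
  [set x | forall P : ifilter A,
     iprime P -> iso_to_subalgebra (wquot P) (luk d) -> P x]%classic.

(* Filters of a Boolean algebra; they need not be proper. *)
Record bfilter (disp : Order.disp_t) (B : ctbDistrLatticeType disp) := BFilter {
  bfilter_set :> B -> Prop;
  bfilter1 : bfilter_set \top%O;
  bfilterI : forall a b, bfilter_set a -> bfilter_set b ->
               bfilter_set (a `&` b)%O;
  bfilter_le : forall a b, (a <= b)%O -> bfilter_set a -> bfilter_set b
}.

Section FilterOfDivisor.
Variables (A : wajsbergType) (d : nat).

Definition hA_set : set (boolean_of A) :=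
  [set a | divisor_filter d (val a)]%classic.

Fact hA_top : hA_set \top%O.
Proof. by move=> P _ _; apply: ifilter1. Qed.

Fact hA_meet a b : hA_set a -> hA_set b -> hA_set (a `&` b)%O.
Proof.
move=> ha hb P Pp Pd; apply: (ifilterMP (hb P Pp Pd)).
apply: ifilter_le (ha P Pp Pd); apply/wodot_adj.
by rewrite wodot_meet; [apply: wle_refl | apply: (eqP (valP a))].
Qed.

Fact hA_le a b : (a <= b)%O -> hA_set a -> hA_set b.
Proof.
by move=> /eqP ab ha P Pp Pd; apply: ifilter_le (ha P Pp Pd); apply: ab.
Qed.

Definition hA : bfilter (boolean_of A) := BFilter hA_top hA_meet hA_le.

End FilterOfDivisor.

(* The index [k] in {1, ..., n} of a function is encoded
   by the ordinal [k - 1 : 'I_n]; [bat f k] is the value at the 1-based index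
   [k] (and a junk value when [k] is not in {1, ..., n}). *)

Definition bfun (n : nat) (B : Type) : Type := {ffun 'I_n -> B}.
HB.instance Definition _ n (B : choiceType) := Choice.on (bfun n B).

Section MBh.
Variables (disp : Order.disp_t) (B : ctbDistrLatticeType disp) (n : nat).
Implicit Types f g : bfun n B.

Definition bimp (a b : B) : B := (~` a `|` b)%O.

Definition bat f (k : nat) : B := oapp f \top%O (insub k.-1).

Definition bfun_imp f g : bfun n B :=
  [ffun j : 'I_n => let k := j.+1 in
    \meet_(1 <= i < (n - k + 1).+1) bimp (bat f i) (bat g (i + k - 1))]%O.
Definition bfun_neg f : bfun n B :=
  [ffun j : 'I_n => let k := j.+1 in ~` (bat f (n + 1 - k))]%O.
Definition bfun_one : bfun n B := [ffun=> \top%O].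

HB.instance Definition _ :=
  hasWajsbergOps.Build (bfun n B) bfun_imp bfun_neg bfun_one.

Definition bincreasing f : Prop :=
  forall i j : nat, 1 <= i -> i <= j -> j <= n -> (bat f i <= bat f j)%O.

Definition xi (d q : nat) f : B :=
  bimp (bat f (q * (n %/ d))) (bat f (q.-1 * (n %/ d) + 1)).

(* Only the values of [h] at the divisors of [n] matter. *)
Definition M (h : nat -> bfilter B) : set (bfun n B) :=
  [set f | bincreasing f /\
     forall d, d %| n -> forall q, 1 <= q <= d -> h d (xi d q f)]%classic.

End MBh.

Section Moisil.
Variables (n : nat) (A : wajsbergType).

Definition is_moisil (i : nat) (s : A -> A) : Prop :=
  (exists t : wterm, forall x, s x = weval (fun=> x) t) /\
  (forall g : A -> luk n, whom g -> forall x,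
     g (s x) = if n - i + 1 <= g x then 1 else wzero).

(* For 1 <= i <= n and (n+1)-valued [A], [is_moisil i] determines a unique
   operation, since the homomorphisms into [luk n] separate points. *)
Definition moisil (i : nat) : A -> A := xget (id : A -> A) (is_moisil i).

End Moisil.

(* Main.v *)
Require Import Defs.
From HB Require Import structures.
From mathcomp Require Import all_boot all_order.
From mathcomp Require Import generic_quotient boolp classical_sets.
From mathcomp Require Import zify.

Set Implicit Arguments.
Unset Strict Implicit.
Unset Printing Implicit Defensive.

Import Order.Theory.
Local Open Scope quotient_scope.
Local Open Scope wajsberg_scope.

(** Every threshold function [x |-> (j <= x)] of [luk n] is given by a
    one-variable term, so membership of [A] in the variety transfers finite
    case analyses on the value of [x] from [luk n] to [A]. If an implicative
    filter decides every idempotent, reading off the value [k] for which the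
    term "[x = k]" lies in it is a homomorphism [A -> luk n]. By Zorn's lemma
    there are enough such filters for the homomorphisms to separate points,
    which reduces all the identities to computations in [luk n].

    For surjectivity, given [f] in [M], the idempotents below which [f] is
    represented by an element of [A] are closed under joins. If [1] were not
    among them, some homomorphism [g] would send none of them to [1]; but the
    image of [g] consists of the multiples of some [m] dividing [n], the
    quotient by its kernel is [luk (n %/ m)], and the condition of [M] at the
    divisor [n %/ m] makes [f] agree, under [g], with an element of [A]. *)

(** * Integer formulas for the operations of [luk n] *)

Section LukValues.
Variable n : nat.
Implicit Types x y : luk n.

Lemma luk_le x : x <= n.
Proof. by rewrite -ltnS ltn_ord. Qed.

Lemma val_luk_zero : (wzero : luk n) = 0 :> nat.
Proof. by rewrite val_luk_neg val_luk_one subnn. Qed.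

Lemma luk_inj x y : x = y :> nat -> x = y. Proof. exact: ord_inj. Qed.

Lemma val_luk_odot x y : wodot x y = x + y - n :> nat.
Proof.
have := (luk_le x, luk_le y) => -[].
by rewrite /wodot !(val_luk_imp, val_luk_neg); lia.
Qed.

Lemma val_luk_join x y : wjoin x y = maxn x y :> nat.
Proof.
have := (luk_le x, luk_le y) => -[].
by rewrite /wjoin !(val_luk_imp, val_luk_neg); lia.
Qed.

Lemma val_luk_meet x y : wmeet x y = minn x y :> nat.
Proof.
have := (luk_le x, luk_le y) => -[].
by rewrite /wmeet !(val_luk_join, val_luk_neg); lia.
Qed.

End LukValues.

Definition luk_bool n (b : bool) : luk n := if b then 1 else wzero.

Lemma val_luk_bool n b : luk_bool n b = b * n :> nat.
Proof. by case: b; rewrite /= ?mul1n // val_luk_zero. Qed.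

Definition lukE :=
  (val_luk_imp, val_luk_neg, val_luk_one, val_luk_zero, val_luk_odot,
   val_luk_join, val_luk_meet, val_luk_bool).

Lemma luk_bool_imp n a b : luk_bool n a ~~> luk_bool n b = luk_bool n (a ==> b).
Proof. by apply: luk_inj; rewrite !lukE; case: a; case: b => /=; lia. Qed.

Lemma luk_bool_neg n a : ¬ (luk_bool n a) = luk_bool n (~~ a).
Proof. by apply: luk_inj; rewrite !lukE; case: a => /=; lia. Qed.

(** * Homomorphisms and one-variable terms *)

Section Hom.
Variables (A B : wopsType) (f : A -> B).
Hypothesis hf : whom f.

Lemma whom1 : f 1 = 1. Proof. by case: hf. Qed.
Lemma whom_imp x y : f (x ~~> y) = f x ~~> f y. Proof. by case: hf. Qed.
Lemma whom_neg x : f (¬ x) = ¬ (f x). Proof. by case: hf. Qed.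
Lemma whom0 : f wzero = wzero. Proof. by rewrite whom_neg whom1. Qed.
Lemma whom_join x y : f (wjoin x y) = wjoin (f x) (f y).
Proof. by rewrite /wjoin !whom_imp. Qed.
Lemma whom_meet x y : f (wmeet x y) = wmeet (f x) (f y).
Proof. by rewrite /wmeet whom_neg whom_join !whom_neg. Qed.
Lemma whom_odot x y : f (wodot x y) = wodot (f x) (f y).
Proof. by rewrite /wodot whom_neg whom_imp whom_neg. Qed.

Lemma whom_weval e t : f (weval e t) = weval (f \o e) t.
Proof.
elim: t => [k|t IHt u IHu|t IHt|] //=.
- by rewrite whom_imp IHt IHu.
- by rewrite whom_neg IHt.
- exact: whom1.
Qed.

Definition homE :=
  (whom1, whom0, whom_imp, whom_neg, whom_join, whom_meet, whom_odot).

End Hom.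

Lemma whom_comp (A B C : wopsType) (f : A -> B) (g : B -> C) :
  whom f -> whom g -> whom (g \o f).
Proof.
by move=> hf hg; split=> [|x y|x] /=; rewrite !(homE hf, homE hg).
Qed.

(* Terms are themselves an algebra, so that substitution is evaluation. *)
HB.instance Definition _ := gen_eqMixin wterm.
HB.instance Definition _ := gen_choiceMixin wterm.
HB.instance Definition _ := hasWajsbergOps.Build wterm TImp TNeg TOne.

Lemma whom_eval (A : wopsType) (e : nat -> A) : whom (weval e).
Proof. by []. Qed.

Definition wop (t : wterm) (A : wopsType) (x : A) : A := weval (fun=> x) t.

Lemma whom_wop (A B : wopsType) (f : A -> B) t x :
  whom f -> f (wop t x) = wop t (f x).
Proof. by move=> hf; rewrite /wop whom_weval. Qed.

Lemma wop_comp (A : wopsType) t u (x : A) : wop (wop t u) x = wop t (wop u x).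
Proof. exact: (whom_wop t u (whom_eval (fun=> x))). Qed.

(** * Threshold terms on [luk n] *)

Section Threshold.
Variable n : nat.
Implicit Types x : luk n.

(* Doubling [x (+) x] or squaring [x (.) x] doubles the gap [b - a] unless
   [n / 2] lies strictly between [a] and [b], when doubling separates them. *)
Lemma gap_term a b : a < b <= n -> exists t, forall x,
  (x <= a -> wop t x < n) /\ (b <= x -> wop t x = n :> nat).
Proof.
have [k] := ubnP (n - (b - a)); elim: k a b => // k IH a b lek abn.
pose D : wterm := ¬ TVar 0 ~~> TVar 0; pose S : wterm := wodot (TVar 0) (TVar 0).
have DE x : wop D x = minn n (x + x) :> nat.
  by have := luk_le x; rewrite /wop /= !lukE; lia.
have SE x : wop S x = x + x - n :> nat.
  by have := luk_le x; rewrite -val_luk_odot.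
have [b2|b2] := leqP (b + b) n.
  have [||t Ht] := IH (a + a) (b + b); [lia|lia|].
  exists (wop t D) => x; rewrite wop_comp; have [H1 H2] := Ht (wop D x).
  by split=> ?; [apply: H1 | apply: H2]; rewrite DE; lia.
have [a2|a2] := leqP n (a + a).
  have [||t Ht] := IH (a + a - n) (b + b - n); [lia|lia|].
  exists (wop t S) => x; rewrite wop_comp; have [H1 H2] := Ht (wop S x).
  by split=> ?; [apply: H1 | apply: H2]; rewrite SE; lia.
by exists D => x; rewrite DE; lia.
Qed.

(** Squaring sends [v] to [2v - n]: it fixes [n] and lowers any other positive value by at least
    one, so [n] squarings leave only [n] and 0. *)
Lemma top_term : exists t, forall x, wop t x = luk_bool n (x == n :> nat).
Proof.
have H k : exists t, forall x, (x = n :> nat -> wop t x = n :> nat) /\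
    (x < n -> wop t x < n /\ wop t x <= n - k).
  elim: k => [|k [t IH]].
    by exists (TVar 0) => x; rewrite /wop /=; lia.
  exists (wodot t t) => x; have [H1 H2] := IH x.
  rewrite {1 2 3}/wop !(whom_odot (whom_eval _)) -/(wop t x) val_luk_odot.
  split=> [/H1|/H2]; lia.
have [t Ht] := H n; exists t => x; apply: luk_inj; rewrite lukE.
have [H1 H2] := Ht x; have := luk_le x.
by case: eqP => [/H1|] ? ?; lia.
Qed.

(** For adjacent levels, [gap_term] reaches the top exactly above the gap; [top_term] then sends
    everything else to 0. *)
Lemma threshold_term j : exists t, forall x, wop t x = luk_bool n (j <= x).
Proof.
case: j => [|j]; first by exists TOne => x; apply: luk_inj; rewrite lukE mul1n.
have [jn|jn] := ltnP j n; last first.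
  exists (¬ TOne) => x; apply: luk_inj; have := luk_le x.
  by rewrite /wop /= !lukE; lia.
have [|t Ht] := @gap_term j j.+1; first lia.
have [u Hu] := top_term; exists (wop u t) => x; rewrite wop_comp Hu.
congr luk_bool; have [H1 H2] := Ht x.
by case: (ltnP j x) => [/H2|/H1] ?; lia.
Qed.

Lemma delta_term : exists t : luk n -> wterm,
  forall k x, wop (t k) x = luk_bool n (x == k).
Proof.
suff H k : exists t, forall x, wop t x = luk_bool n (x == k).
  by have [t Ht] := choice H; exists t.
have [t Ht] := threshold_term k.
have [u Hu] := threshold_term k.+1.
exists (wodot t (¬ u)) => x.
rewrite {1}/wop !(whom_odot (whom_eval _), whom_neg (whom_eval _)).
rewrite -/(wop t x) -/(wop u x) Ht Hu; apply: luk_inj; rewrite !lukE.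
by rewrite -val_eqE /=; case: (ltngtP k x) => /= ?; lia.
Qed.

End Threshold.

(** The equations valid in [luk n] define a variety containing [luk n], hence [A]. *)
Lemma valued_identity n (A : wajsbergType) (u v : wterm) : valued n A ->
  (forall e : nat -> luk n, weval e u = weval e v) ->
  forall e : nat -> A, weval e u = weval e v.
Proof.
move=> Aval huv.
pose E : set (wterm * wterm) := [set eqn | wsatisfies (luk n) eqn]%classic.
apply: (Aval (fun W => forall eqn, E eqn -> wsatisfies W eqn) _ _ (u, v)) => //.
by exists E.
Qed.

(** * Maximal filters and idempotents *)

Section PrimeFilter.
Variable A : wajsbergType.
Implicit Types b x y : A.

Lemma idem_joinN b : wodot b b = b -> wjoin b (¬ b) = 1.
Proof. by move=> /eqP bb; apply: (congr1 val (bool_joinxC (Boolean bb))). Qed.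

(** Case analysis on [b]: multiplication distributes over [b] joined with [¬ b], and modus ponens
    applies to each part. *)
Lemma idem_cases b z : wodot b b = b ->
  (b ~~> z) ~~> ((¬ b ~~> z) ~~> z) = 1.
Proof.
move=> bb; apply/wodot_adj; set w := wodot _ _.
have -> : w = wodot w (wjoin b (¬ b)).
  by rewrite idem_joinN // /wodot -/(@wzero A) -wnegE wnegK.
rewrite wodot_joinr; apply: wjoin_lub; apply/wodot_adj.
  exact: wodot_lel.
exact: wodot_ler.
Qed.

Lemma exists_deciding_ifilter (I : set A) :
  ~ I 1 -> (forall x y, I x -> I y -> I (wjoin x y)) ->
  exists P : ifilter A, (forall x, I x -> ~ P x) /\
    forall b, wodot b b = b -> P b \/ P (¬ b).
Proof.
move=> I1 IU.
(* The empty chain has empty union, so 1 is required only of nonempty sets. A maximal set contains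
   1, since otherwise it would be empty and [{1}] would be larger. *)
pose closed (S : set A) := [/\ forall a, S a -> S 1,
  forall a b, S a -> S (a ~~> b) -> S b & forall x, I x -> ~ S x].
have [|S [[S1 SMP SI] Smax]] := @Zorn_bigcup A closed.
  move=> F Fc Ftot; split=> [a [X FX Xa]|a b [X FX Xa] [Y FY Yb]|x Ix [X FX Xx]].
  - by exists X => //; case: (Fc X FX) => H _ _; apply: H Xa.
  - have [XY|YX] := Ftot _ _ FX FY.
      by exists Y => //; case: (Fc Y FY) => _ H _; apply: H (XY _ Xa) Yb.
    by exists X => //; case: (Fc X FX) => _ H _; apply: H Xa (YX _ Yb).
  - by case: (Fc X FX) => _ _ /(_ x Ix).
have {}S1 : S 1.
  apply: contrapT => nS1; apply: (Smax [set 1 : A]%classic).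
    split=> [a /S1 //|H]; by apply/nS1/H.
  split=> //; first by move=> a b -> /=; rewrite wimp1x.
  by move=> x Ix /= xE; apply: I1; rewrite -xE.
pose P := IFilter S1 SMP.
exists P; split=> // b bb; apply: contrapT => /not_orP[nb nNb].
(* [Q] is the filter generated by [P] and [c]; idempotency of [c] contracts [c ~~> (c ~~> d)] to
   [c ~~> d]. By maximality [Q] meets [I]. *)
have ext c : wodot c c = c -> ~ P c -> exists2 z, I z & P (c ~~> z).
  move=> cc nc; apply: contrapT => nz.
  pose Q : set A := [set x | P (c ~~> x)]%classic.
  apply: (Smax Q).
    split=> [x Sx|H]; first exact: (ifilter_le (F := P) (wle_impK x c) Sx).
    by apply/nc/H; rewrite /Q /= wimpxx.
  split=> [a _||x Ix Qx]; last by apply: nz; exists x.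
    by rewrite /Q /= wle1.
  move=> a d; rewrite /Q /= => Pa Pad.
  have Pcad : P (c ~~> (c ~~> d)).
    apply: (ifilterMP (i := P) Pa); apply: (ifilter_le (F := P) _ Pad).
    by rewrite (wimpCA c a d) /wle wimpCA; apply: wimp_trans.
  apply: (ifilter_le (F := P) _ Pcad); rewrite /wle -{3}cc.
  have -> : wodot c c ~~> d = c ~~> (c ~~> d).
    by rewrite /wodot -{1}(wnegK d) wimpNN wimpCA wimpNN.
  exact: wimpxx.
have [z Iz Pz] := ext _ bb nb.
have [z' Iz' Pz'] := ext _ (wodot_neg bb) nNb.
(* Both [b] and [¬ b] imply the join of [z] and [z'] modulo [P], so this element of [I] would lie in
   [P]. *)
apply: (SI _ (IU _ _ Iz Iz')).
apply: (ifilterMP (i := P) (ifilter_le (wle_imp2l (¬ b) (wle_joinr z z')) Pz')).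
apply: (ifilterMP (i := P) (ifilter_le (wle_imp2l b (wle_joinl z z')) Pz)).
by rewrite idem_cases //; apply: ifilter1.
Qed.

End PrimeFilter.

(** * Homomorphisms into [luk n] separate points *)

Section ExistsHom.
Variables (n : nat) (A : wajsbergType).
Hypothesis Aval : valued n A.

Lemma exists_hom_avoiding (I : set A) :
  ~ I 1 -> I wzero -> (forall x y, I x -> I y -> I (wjoin x y)) ->
  exists2 g : A -> luk n, whom g & forall x, I x -> g x <> 1.
Proof.
move=> I1 I0 IU; have [P [PI Pdec]] := exists_deciding_ifilter I1 IU.
have nP0 := PI _ I0; have [t Ht] := delta_term n.
have evalt (W : wopsType) (e : nat -> W) k u :
    weval e (wop (t k) u) = wop (t k) (weval e u).
  exact: (whom_wop _ _ (whom_eval e)).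
pose e2 (x y : A) k := if k is 0 then x else y.
have idem k (x : A) : wodot (wop (t k) x) (wop (t k) x) = wop (t k) x.
  pose u : wterm := wodot (wop (t k) (TVar 0)) (wop (t k) (TVar 0)).
  have := @valued_identity n A u (wop (t k) (TVar 0)) Aval _ (fun=> x).
  rewrite /u !(whom_odot (whom_eval _)) !evalt /=; apply=> e.
  by rewrite /= !evalt Ht luk_bool_neg luk_bool_imp luk_bool_neg; case: eqP.
have ex_delta (x : A) : exists k, P (wop (t k) x).
  apply: contrapT => nex.
  (* [excl] derives 0 from the failure of every delta term. It is identically 1 in [luk n], where
     some delta holds, so a proper deciding filter contains a delta. *)
  pose excl (W : wopsType) (y : W) s :=
    foldr (fun k z => ¬ (wop (t k) y) ~~> z) wzero s.
  have evalE (W : wopsType) (e : nat -> W) s :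
      weval e (excl _ (TVar 0) s) = excl _ (e 0) s.
    by elim: s => //= k s IH; rewrite evalt IH.
  have : excl A x (enum 'I_n.+1) = 1.
    have := @valued_identity n A (excl _ (TVar 0) (enum 'I_n.+1)) TOne Aval _ (fun=> x).
    rewrite evalE; apply=> e; rewrite evalE /=.
    have : (e 0 : 'I_n.+1) \in enum 'I_n.+1 by rewrite mem_enum.
    elim: (enum 'I_n.+1) => [|k s IH] //=; rewrite inE Ht luk_bool_neg => /orP[/eqP -> | /IH ->].
      by rewrite eqxx; apply: wle0.
    exact: wle1.
  have PE s : P (excl A x s) -> P wzero.
    elim: s => //= k s IH H; apply/IH; apply: ifilterMP H.
    by have [Pk|//] := Pdec _ (idem k x); case: nex; exists k.
  by move=> E; apply/nP0/(PE (enum 'I_n.+1)); rewrite E; apply: ifilter1.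
have [g gP] := choice ex_delta.
have uniq_delta (x : A) k : P (wop (t k) x) -> g x = k.
  move=> Pk; have [//|neq] := eqVneq (g x) k; case: nP0.
  have E : wop (t (g x)) x ~~> (wop (t k) x ~~> wzero) = 1.
    pose u : wterm := wop (t (g x)) (TVar 0) ~~> (wop (t k) (TVar 0) ~~> wzero).
    have := @valued_identity n A u TOne Aval _ (fun=> x).
    rewrite /u /= !evalt /=; apply=> e; rewrite /= !evalt /= !Ht.
    rewrite -[¬ 1]/(luk_bool n false) !luk_bool_imp.
    by case: (altP (e 0 =P g x)) => // ->; rewrite (negPf neq).
  by apply: (ifilterMP Pk); apply: (ifilterMP (gP x)); rewrite E; apply: ifilter1.
exists g; first split=> [|x y|x].
- apply: uniq_delta.
  have -> : wop (t 1) (1 : A) = 1; last exact: ifilter1.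
  have := @valued_identity n A (wop (t 1) TOne) TOne Aval _ (fun=> 1).
  by rewrite evalt /=; apply=> e; rewrite evalt /= Ht eqxx.
- apply: uniq_delta; apply: (ifilterMP (gP y)); apply: (ifilterMP (gP x)).
  set k := g x; set l := g y.
  suff -> : wop (t k) x ~~> (wop (t l) y ~~> wop (t (k ~~> l)) (x ~~> y)) = 1.
    exact: ifilter1.
  pose u : wterm := wop (t k) (TVar 0) ~~> (wop (t l) (TVar 1) ~~>
    wop (t (k ~~> l)) (TVar 0 ~~> TVar 1)).
  have := @valued_identity n A u TOne Aval _ (e2 x y).
  rewrite /u /= !evalt /=; apply=> e; rewrite /= !evalt /= !Ht !luk_bool_imp.
  by case: eqP => // ->; case: eqP => //= ->; rewrite eqxx.
- apply: uniq_delta; apply: (ifilterMP (gP x)); set k := g x.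
  suff -> : wop (t k) x ~~> wop (t (¬ k)) (¬ x) = 1 by exact: ifilter1.
  pose u : wterm := wop (t k) (TVar 0) ~~> wop (t (¬ k)) (¬ TVar 0).
  have := @valued_identity n A u TOne Aval _ (fun=> x).
  rewrite /u /= !evalt /=; apply=> e; rewrite /= !evalt /= !Ht !luk_bool_imp.
  by case: eqP => // ->; rewrite eqxx.
move=> x /PI nPx gx; apply: nPx; have := gP x; rewrite gx => /ifilterMP; apply.
suff -> : wop (t 1) x ~~> x = 1 by exact: ifilter1.
have := @valued_identity n A (wop (t 1) (TVar 0) ~~> TVar 0) TOne Aval _ (fun=> x).
rewrite /= !evalt /=; apply=> e; rewrite /= !evalt /= !Ht.
by case: eqP => [->|_]; [apply: wimpxx | apply: wle0].
Qed.

(** If [u] is not below [v], some homomorphism avoids 1 on all elements below [u ~~> v], so it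
    cannot identify [u] and [v]. *)
Lemma hom_separate (x y : A) :
  (forall g : A -> luk n, whom g -> g x = g y) -> x = y.
Proof.
move=> H; have le u v : (forall g : A -> luk n, whom g -> g u = g v) -> wle u v.
  move=> Huv; apply: contrapT => nle.
  have [||b c|g hg] := @exists_hom_avoiding [set b | wle b (u ~~> v)]%classic.
  - by move=> /wle1x.
  - exact: wle0.
  - exact: wjoin_lub.
  move=> /(_ _ (wle_refl _)); apply.
  by rewrite (homE hg) (Huv g hg) wimpxx.
by apply: wle_anti; apply: le => // g /H.
Qed.
End ExistsHom.

(** * Idempotents, kernel and image of a homomorphism *)

Lemma luk_idem n (x : luk n) : wodot x x = x -> x = luk_bool n (x == 1).
Proof.
move=> /(congr1 (@nat_of_ord _)) xx; case: eqP => [-> //|neq].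
have xn : x <> n :> nat by move=> xn; apply/neq/luk_inj.
by apply: luk_inj; have := luk_le x; move: xx; rewrite !lukE; lia.
Qed.

Definition hom_bool n (A : wajsbergType) (g : A -> luk n) (b : boolean_of A) :=
  g (val b) == 1.

Section HomBool.
Variables (n : nat) (A : wajsbergType) (g : A -> luk n).
Hypotheses (n_gt0 : 0 < n) (hg : whom g).
Implicit Types a b : boolean_of A.

Lemma luk_bool_eq1 c : (luk_bool n c == 1) = c.
Proof. by rewrite -val_eqE /= lukE; case: c => /=; lia. Qed.

Lemma hom_boolE b : g (val b) = luk_bool n (hom_bool g b).
Proof. by apply: luk_idem; rewrite -(homE hg) (eqP (valP b)). Qed.

Lemma hom_bool_top : hom_bool g \top%O.
Proof. by rewrite /hom_bool (homE hg). Qed.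

Lemma hom_bool_meet a b :
  hom_bool g (a `&` b)%O = hom_bool g a && hom_bool g b.
Proof.
rewrite -[LHS]luk_bool_eq1 -[RHS]luk_bool_eq1; congr (_ == _).
rewrite -hom_boolE (whom_meet hg) !hom_boolE; apply: luk_inj; rewrite !lukE.
by do 2!case: hom_bool => /=; lia.
Qed.

Lemma hom_bool_compl a : hom_bool g (~` a)%O = ~~ hom_bool g a.
Proof.
rewrite -[LHS]luk_bool_eq1 -[RHS]luk_bool_eq1; congr (_ == _).
by rewrite -hom_boolE (whom_neg hg) !hom_boolE luk_bool_neg.
Qed.

Lemma hom_bool_imp a b :
  hom_bool g (bimp a b) = (hom_bool g a ==> hom_bool g b).
Proof.
rewrite /bimp -[b in LHS]complK -complI hom_bool_compl hom_bool_meet.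
by rewrite hom_bool_compl negb_and negbK implybE.
Qed.

Lemma hom_bool_bigmeet (s : seq nat) (F : nat -> boolean_of A) :
  hom_bool g (\meet_(i <- s) F i)%O = all (fun i => hom_bool g (F i)) s.
Proof.
by rewrite (big_morph _ hom_bool_meet hom_bool_top) big_all.
Qed.

Lemma hom_kernel_exists : exists K : ifilter A,
  iprime K /\ forall x, K x <-> g x = 1.
Proof.
have K1 : g 1 = 1 by rewrite (homE hg).
have KMP (a b : A) : g a = 1 -> g (a ~~> b) = 1 -> g b = 1.
  by rewrite (homE hg) => ->; rewrite wimp1x.
exists (IFilter (ifilter_set := fun x => g x = 1) K1 KMP); split=> //; split=> /=.
  by rewrite (homE hg) => /(congr1 (@nat_of_ord _)); rewrite !lukE; lia.
move=> x y /(congr1 (@nat_of_ord _)); rewrite (homE hg) !lukE => xy.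
have : g x = n :> nat \/ g y = n :> nat by lia.
by case=> E; [left|right]; apply: luk_inj.
Qed.

(** Take [m] to be the least positive value of [g]: remainders modulo [m] are again values, hence 0,
    and truncated sums give all multiples up to [n]. *)
Lemma hom_image_divisor : exists m,
  [/\ 0 < m, m %| n, forall x, m %| g x &
      forall r, r <= n -> m %| r -> exists x, g x = r :> nat].
Proof.
pose p k := (0 < k) && `[< exists x, g x = k :> nat >].
have exp : exists k, p k.
  by exists n; rewrite /p n_gt0; apply/asboolP; exists 1; rewrite (homE hg).
have [m /andP[m0 /asboolP[x0 gx0]] mmin] := ex_minnP exp.
have gsub k x : exists z, g z = g x - k * m :> nat.
  elim: k => [|k [z gz]]; first by exists x; lia.
  (* This is truncated subtraction of [x0] from [z]. *)
  exists (¬ (z ~~> x0)); rewrite !(homE hg) !lukE gz gx0.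
  by have := luk_le (g x); lia.
have mdiv x : m %| g x.
  have [z gz] := gsub (g x %/ m) x.
  have {}gz : g z = g x %% m :> nat.
    by rewrite gz {1}(divn_eq (g x) m) addKn.
  rewrite /dvdn; have [//|gt0] := posnP (g x %% m).
  have : m <= g x %% m.
    by apply: mmin; rewrite /p gt0; apply/asboolP; exists z.
  by rewrite leqNgt ltn_pmod.
exists m; split=> //; first by have := mdiv 1; rewrite (homE hg).
move=> r rn /dvdnP[k rE]; rewrite {r}rE in rn *.
elim: k rn => [|k IH] rn; first by exists wzero; rewrite (homE hg) lukE.
have [|x gx] := IH; first by lia.
exists (¬ x ~~> x0); rewrite !(homE hg) !lukE gx gx0.
by lia.
Qed.

(** Dividing values by [m] maps the quotient onto all of [luk (n %/ m)], so the subalgebra is the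
    full set. *)
Lemma wquot_kernel_iso (K : ifilter A) m :
  (forall x, K x <-> g x = 1) -> 0 < m -> m %| n ->
  (forall x, m %| g x) ->
  (forall r, r <= n -> m %| r -> exists x, g x = r :> nat) ->
  iso_to_subalgebra (wquot K) (luk (n %/ m)).
Proof.
move=> Kg m0 mn mdiv msurj; set d := n %/ m.
have nE : n = d * m by rewrite divnK.
have fcongE x y : fcong K x y -> g x = g y.
  move=> /asboolP[/Kg + /Kg]; rewrite !(homE hg).
  move=> /(congr1 (@nat_of_ord _)) + /(congr1 (@nat_of_ord _)).
  rewrite !lukE => E1 E2; apply: luk_inj.
  by have := (luk_le (g x), luk_le (g y)) => -[]; lia.
have grepr x : g (repr (\pi_(wquot K) x)) = g x by exact/fcongE/fcong_repr.
pose f (u : wquot K) : luk d := inord (g (repr u) %/ m).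
have fE u : f u = g (repr u) %/ m :> nat.
  by rewrite inordK // ltnS leq_div2r // luk_le.
have fM u : g (repr u) = f u * m :> nat by rewrite fE divnK.
have fpi x (a : nat) : g x = a * m :> nat -> f (\pi x) = a :> nat.
  by move=> gx; rewrite fE grepr gx mulnK.
exists setT; split=> //; exists f; split=> // [|u v uv|y _].
- split=> [|u v|u]; apply: luk_inj; rewrite ?lukE; apply: fpi.
  + by rewrite (homE hg) lukE.
  + by rewrite (homE hg) lukE !fM minnMl mulnDl mulnBl -nE.
  + by rewrite (homE hg) lukE fM mulnBl -nE.
- rewrite -[u]reprK -[v]reprK; apply/eqmodP; apply/asboolP.
  have E : g (repr u) = g (repr v) by apply: luk_inj; rewrite !fM uv.
  by split; apply/Kg; rewrite (homE hg) E wimpxx.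
- have [||x gx] := msurj (y * m); last 1 first.
  + by exists (\pi x); apply: luk_inj; apply: fpi.
  + by rewrite [X in _ <= X]nE leq_mul2r luk_le orbT.
  + exact: dvdn_mull.
Qed.

End HomBool.

Lemma luk_scale_hom n d m : d * m = n ->
  whom (fun k : luk d => inord (k * m) : luk n).
Proof.
move=> <-; have vE (k : luk d) : (inord (k * m) : luk (d * m)) = k * m :> nat.
  by rewrite inordK // ltnS leq_mul2r luk_le orbT.
split=> [|x y|x]; apply: luk_inj; rewrite vE !lukE ?vE //.
  by rewrite minnMl mulnDl mulnBl.
by rewrite mulnBl.
Qed.

Lemma batE disp (B : ctbDistrLatticeType disp) n (f : bfun n B) k
  (kn : k.-1 < n) : bat f k = f (Ordinal kn).
Proof. by rewrite /bat insubT. Qed.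

(** * The Moisil map and its bijectivity onto [M] *)

Section Representation.
Variables (n : nat) (A : wajsbergType) (t : nat -> wterm).
Hypotheses (n_gt0 : 0 < n) (Aval : valued n A).
Hypothesis tE : forall j (x : luk n), wop (t j) x = luk_bool n (j <= x).
Implicit Types x y : A.

Lemma hom_threshold (g : A -> luk n) j x :
  whom g -> g (wop (t j) x) = luk_bool n (j <= g x).
Proof. by move=> hg; rewrite whom_wop // tE. Qed.

Lemma threshold_idem j x : wodot (wop (t j) x) (wop (t j) x) == wop (t j) x.
Proof.
apply/eqP/(hom_separate Aval) => g hg.
rewrite (whom_odot hg) hom_threshold //; apply: luk_inj; rewrite !lukE.
by case: leqP => _; lia.
Qed.

(* At the 1-based index [i = j + 1] the Moisil threshold [n - i + 1] is
   [n - j]. *)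
Definition moisil_fun x : bfun n (boolean_of A) :=
  [ffun j : 'I_n => Boolean (threshold_idem (n - j) x)].

Lemma bat_moisil_fun x i : 1 <= i <= n ->
  val (bat (moisil_fun x) i) = wop (t (n - i + 1)) x.
Proof.
move=> ilen; have i1n : i.-1 < n by lia.
by rewrite (batE _ i1n) ffunE /=; congr (wop (t _) x); lia.
Qed.

Lemma hom_bool_moisil_fun (g : A -> luk n) x i : whom g -> 1 <= i <= n ->
  hom_bool g (bat (moisil_fun x) i) = (n - i + 1 <= g x).
Proof.
move=> hg ilen.
by rewrite /hom_bool bat_moisil_fun // hom_threshold // luk_bool_eq1.
Qed.

Lemma hom_bool_moisil_ffun (g : A -> luk n) x (j : 'I_n) : whom g ->
  hom_bool g (moisil_fun x j) = (n - j <= g x).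
Proof.
by move=> hg; rewrite /hom_bool ffunE hom_threshold // luk_bool_eq1.
Qed.

Lemma hom_bool_sep (a b : boolean_of A) :
  (forall g : A -> luk n, whom g -> hom_bool g a = hom_bool g b) -> a = b.
Proof.
move=> H; apply/val_inj/(hom_separate Aval) => g hg.
by rewrite !hom_boolE // H.
Qed.

Lemma bool_le_hom (a b : boolean_of A) :
  (forall g : A -> luk n, whom g -> hom_bool g a -> hom_bool g b) -> (a <= b)%O.
Proof.
move=> H; apply/meet_idPl/hom_bool_sep => g hg; rewrite hom_bool_meet //.
by have := H g hg; do 2!case: hom_bool => //; move=> /(_ isT).
Qed.

(** The threshold term shows that the choice made by [xget] is not the default; separation of points
    identifies the two. *)
Lemma moisilE i x : 1 <= i <= n -> moisil n i x = wop (t (n - i + 1)) x.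
Proof.
move=> ilen; have [|_ Hm] := @xgetPex _ (id : A -> A) (is_moisil n i).
  exists (fun x => wop (t (n - i + 1)) x); split; first by exists (t (n - i + 1)).
  by move=> g hg y; rewrite hom_threshold.
by apply: (hom_separate Aval) => g hg; rewrite Hm // hom_threshold.
Qed.

Lemma moisil_fun_increasing x : bincreasing (moisil_fun x).
Proof.
move=> i j i1 ij jn; apply: bool_le_hom => g hg.
by rewrite !hom_bool_moisil_fun //; lia.
Qed.

(** The quotient by [P], embedded in [luk d] and scaled by [m], gives a homomorphism [g] whose
    values are multiples of [m]. Such a value exceeding [(d - q) * m] is at least
    [(d - q.+1 + 2) * m], the next multiple. *)
Lemma moisil_fun_xi x d q :
  d %| n -> 1 <= q <= d -> hA A d (xi d q (moisil_fun x)).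
Proof.
move=> dn qd P Pp [S [_ [f [_ hf finj _]]]]; set m := n %/ d.
have nE : d * m = n by rewrite mulnC divnK.
have m0 : 0 < m by move: n_gt0; rewrite -nE muln_gt0 => /andP[].
pose f0 := f \o \pi_(wquot P); have hf0 : whom f0 := whom_comp (wpi_hom P) hf.
pose g : A -> luk n := (fun k : luk d => inord (k * m) : luk n) \o f0.
have hg : whom g := whom_comp hf0 (luk_scale_hom nE).
have gE y : g y = f0 y * m :> nat.
  by rewrite /g /= inordK // ltnS -[X in _ <= X]nE leq_mul2r luk_le orbT.
have fP y : f0 y = 1 -> P y.
  rewrite -(whom1 hf0) => /finj /eqmodP /asboolP[_].
  by rewrite wimp1x.
apply: fP; apply: luk_inj; apply/eqP.
rewrite -(eqn_pmul2r m0) -gE hom_boolE // hom_bool_imp //.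
have qm : 1 <= q * m <= n by rewrite -nE; nia.
have qm1 : 1 <= q.-1 * m + 1 <= n by rewrite -nE; nia.
rewrite !hom_bool_moisil_fun // gE !lukE.
suff -> : (n - q * m + 1 <= f0 x * m) ==> (n - (q.-1 * m + 1) + 1 <= f0 x * m).
  by rewrite nE mul1n.
apply/implyP; rewrite addn1 -nE -mulnBl ltn_pmul2r // => lt.
rewrite subnDA subnK; last by move: qm1; rewrite nE; lia.
by rewrite -mulnBl leq_mul2r; lia.
Qed.

Lemma moisil_fun_hom : whom moisil_fun.
Proof.
split=> [|x y|x]; apply/ffunP => j; apply: hom_bool_sep => g hg;
  rewrite hom_bool_moisil_ffun // ?(homE hg) !ffunE lukE.
- by rewrite hom_bool_top // leq_subr.
- rewrite hom_bool_bigmeet //.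
  have := (luk_le (g x), luk_le (g y), ltn_ord j) => -[[gx gy] jn].
  apply/idP/allP => [H i|H].
    rewrite mem_index_iota => ilen; rewrite hom_bool_imp //.
    by rewrite !hom_bool_moisil_fun //; lia.
  have [//|lt] := leqP (n - j) (minn n (n - g x + g y)).
  (* The first index where the threshold of [x] holds gives the strictest conjunct. It is in range,
     since [g x <= j] would contradict [lt]. *)
  have := H (n - g x + 1); rewrite mem_index_iota hom_bool_imp //.
  by rewrite !hom_bool_moisil_fun //; lia.
- rewrite hom_bool_compl //.
  have := (luk_le (g x), ltn_ord j) => -[gx jn].
  by rewrite hom_bool_moisil_fun //; lia.
Qed.

(** The component at index [n - g x + 1] tests [g x <= g y]. That index leaves the range only when
    [g x] is 0 and the test is trivial. *)
Lemma moisil_fun_inj : injective moisil_fun.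
Proof.
move=> x y xy; apply: (hom_separate Aval) => g hg; apply: luk_inj.
have H i : 1 <= i <= n -> (n - i + 1 <= g x) = (n - i + 1 <= g y).
  by move=> ilen; rewrite -!hom_bool_moisil_fun // xy.
have := (luk_le (g x), luk_le (g y)) => -[gx gy].
have := (H (n - g x + 1), H (n - g y + 1)) => -[].
by lia.
Qed.

Lemma hom_bool_increasing (g : A -> luk n) (f : bfun n (boolean_of A)) i j :
  whom g -> bincreasing f -> 1 <= i -> i <= j -> j <= n ->
  hom_bool g (bat f i) -> hom_bool g (bat f j).
Proof.
move=> hg finc i1 ij jn; have /meet_idPl <- := finc i j i1 ij jn.
by rewrite hom_bool_meet // => /andP[].
Qed.

(* In a fibre whose image is the set of multiples of [m = n / d], the
   conditions [xi d q f] force [f] to jump at the beginning of a block of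
   length [m], that is, to represent a value of the fibre. *)
Lemma fibre_value (g : A -> luk n) (f : bfun n (boolean_of A)) d m :
  whom g -> bincreasing f -> d * m = n ->
  (forall q, 1 <= q <= d -> hom_bool g (bat f (q * m)) ->
     hom_bool g (bat f (q.-1 * m + 1))) ->
  exists r, [/\ r <= n, m %| r & forall i, 1 <= i <= n ->
    hom_bool g (bat f i) = (n - i + 1 <= r)].
Proof.
move=> hg finc nE hq; pose p i := (1 <= i <= n) && hom_bool g (bat f i).
have m0 : 0 < m by move: n_gt0; rewrite -nE muln_gt0 => /andP[].
have [exp|nexp] := pselect (exists i, p i); last first.
  exists 0; split=> // i ilen; rewrite addn1; apply/negP => fi.
  by apply: nexp; exists i; rewrite /p ilen.
have [i0 /andP[i0len fi0] i0min] := ex_minnP exp.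
(* The least true index [i0] lies in the block from [k * m + 1] to [k.+1 * m]. Monotonicity makes
   [f] true at the end of the block and [hq] at its start, which is therefore [i0]. *)
pose k := i0.-1 %/ m; have kE := divn_eq i0.-1 m; rewrite -/k in kE.
have mod_lt : i0.-1 %% m < m by rewrite ltn_pmod.
have kd : k < d by rewrite ltn_divLR // nE; lia.
have kmn : k.+1 * m <= n by rewrite -nE leq_mul2r kd orbT.
have i0E : i0 = k * m + 1.
  have : p (k * m + 1).
    have fk : hom_bool g (bat f (k * m + 1)).
      apply: (hq k.+1) => //; apply: hom_bool_increasing fi0 => //; first lia.
      by rewrite mulSn; lia.
    by rewrite /p fk andbT; move: kmn; rewrite mulSn; lia.
  by move=> /i0min; lia.
exists (n - k * m); split=> [||i ilen].
- exact: leq_subr.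
- by rewrite -nE -mulnBl dvdn_mull.
apply/idP/idP => [fi|le].
  by have := i0min i; rewrite /p ilen fi => /(_ isT); lia.
by apply: hom_bool_increasing fi0 => //; lia.
Qed.

Lemma moisil_fun_surj f : M (hA A) f -> exists x, moisil_fun x = f.
Proof.
move=> [finc fxi].
pose agree x (g : A -> luk n) := forall i, 1 <= i <= n ->
  hom_bool g (bat f i) = (n - i + 1 <= g x).
pose I : set A := [set b | wodot b b = b /\
  exists x, forall g : A -> luk n, whom g -> g b = 1 -> agree x g]%classic.
suff [_ [x Hx]] : I 1.
  exists x; apply/ffunP => j; apply: hom_bool_sep => g hg.
  have jn := ltn_ord j; rewrite hom_bool_moisil_ffun //.
  have := Hx g hg (whom1 hg) j.+1 jn; rewrite (batE _ (jn : j.+1.-1 < n)).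
  rewrite (_ : Ordinal _ = j) => [->|]; last exact: val_inj.
  by congr (_ <= _); lia.
apply: contrapT => nI1.
have [||g hg gI] := exists_hom_avoiding Aval nI1.
- split; first exact: (eqP (valP (\bot%O : boolean_of A))).
  (* Any witness would do: no homomorphism sends 0 to 1. *)
  exists 1 => g hg /(congr1 (@nat_of_ord _)).
  by rewrite (whom0 hg) !lukE; lia.
- move=> b c [bb [x Hx]] [cc [y Hy]]; split; first exact: wodot_join_idem.
  (* Gluing: this element takes the value of [x] where [b] is 1 and that of [y] where [b] is 0. *)
  exists (wjoin (wmeet b x) (wmeet (¬ b) y)) => g hg.
  have [gb _|gb] := eqVneq (g b) 1.
    move=> i ilen; rewrite (Hx g hg gb) //; congr (_ <= _).
    rewrite !(whom_join hg, whom_meet hg, whom_neg hg) !lukE gb.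
    by have := luk_le (g x); rewrite lukE; lia.
  have gb0 : g b = wzero.
    have := @luk_idem n (g b); rewrite -(whom_odot hg) bb => /(_ erefl) ->.
    by rewrite (negPf gb).
  rewrite (whom_join hg) gb0 => gc.
  have {}gc : g c = 1 by rewrite -gc /wjoin wle0 wimp1x.
  move=> i ilen; rewrite (Hy g hg gc) //; congr (_ <= _).
  rewrite !(whom_join hg, whom_meet hg, whom_neg hg) !lukE gb0.
  by have := luk_le (g y); rewrite lukE; lia.
have [m [m0 mn mdiv msurj]] := hom_image_divisor n_gt0 hg.
have [K [Kp Kg]] := hom_kernel_exists n_gt0 hg.
have Kiso := wquot_kernel_iso n_gt0 hg Kg m0 mn mdiv msurj.
have nE : n %/ m * m = n by rewrite divnK.
have [|r [rn mr fr]] := fibre_value hg finc nE.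
  move=> q qd; have dn : n %/ m %| n by rewrite -{2}nE dvdn_mulr.
  (* The kernel [K] is one of the primes intersected in [hA A (n %/ m)]. *)
  have /Kg := fxi _ dn q qd K Kp Kiso.
  have -> : xi (n %/ m) q f = bimp (bat f (q * m)) (bat f (q.-1 * m + 1)).
    by rewrite /xi divnA // mulKn.
  by move=> /eqP; rewrite -/(hom_bool g _) hom_bool_imp // => /implyP.
have [x gx] := msurj r rn mr.
(* The meet [b] of these equivalences is 1 exactly at the homomorphisms where [x] represents [f].
   Hence [b] is in [I], yet [g] sends it to 1. *)
pose eqv i := (bimp (bat (moisil_fun x) i) (bat f i) `&`
  bimp (bat f i) (bat (moisil_fun x) i))%O.
pose b := (\meet_(i <- iota 1 n) eqv i)%O.
have bE (g' : A -> luk n) : whom g' -> hom_bool g' b <-> agree x g'.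
  move=> hg'; rewrite /b hom_bool_bigmeet //; split=> [/allP H i ilen|H].
    have := H i; rewrite mem_iota hom_bool_meet // !hom_bool_imp //.
    rewrite hom_bool_moisil_fun // => /(_ _); case: hom_bool => /=; lia.
  apply/allP => i; rewrite mem_iota => ilen; have {}ilen : 1 <= i <= n by lia.
  rewrite hom_bool_meet // !hom_bool_imp // hom_bool_moisil_fun // H //.
  by rewrite implybb.
apply: (gI (val b)); last by apply/eqP/bE => // i ilen; rewrite gx fr.
split; first exact: (eqP (valP b)).
by exists x => g' hg' /eqP /bE; apply.
Qed.

End Representation.

Theorem theorem2 (n : nat) (A : wajsbergType) :
  0 < n -> valued n A ->
  exists phi : A -> bfun n (boolean_of A),
    (forall (x : A) (i : nat), 1 <= i <= n ->
       val (bat (phi x) i) = moisil n i x) /\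
    wiso_onto phi (M (hA A)).
Proof.
move=> n_gt0 Aval; have [t tE] := choice (threshold_term n).
exists (moisil_fun n_gt0 Aval tE); split=> [x i ilen|].
  by rewrite bat_moisil_fun // (moisilE Aval tE).
split=> [x|||f].
- split; first exact: moisil_fun_increasing.
  by move=> d dn q qd; apply: moisil_fun_xi.
- exact: moisil_fun_hom.
- exact: moisil_fun_inj.
- exact: moisil_fun_surj.
Qed.
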